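(* Let $X$ be a nonempty finite or countably infinite set, and let $\Lambda\subseteq X$ be a finite subset. Then the following conditions on a matrix $\alpha=(\alpha_{xy})_{x,y\in X}$ with nonnegative real entries are equivalent: (a) $\operatorname{spr}(I_\Lambda\alpha I_\Lambda)<1$. (b) For all $h\colon X\to[0,1]$ with $\operatorname{supp}h=\Lambda$, we have $\operatorname{spr}(I_\Lambda\beta_hI_\Lambda)<1$. (b$'$) There exists $h\colon X\to[0,1]$ with $\operatorname{supp}h\subseteq\Lambda$ such that $\operatorname{spr}(I_\Lambda\beta_hI_\Lambda)<1$. (c) For every finite sequence $f_1,\ldots,f_m$ of functions $X\to[0,1]$ with $\operatorname{supp}(\sum_{i=1}^mf_i)=\Lambda$, we have $\operatorname{spr}(I_\Lambda\beta_{f_1}\cdots\beta_{f_m}I_\Lambda)<1$. (c$'$) There exists a finite sequence $f_1,\ldots,f_m$ of functions $X\to[0,1]$ with $\operatorname{supp}(f_i)\subseteq\Lambda$ such that $\operatorname{spr}(I_\Lambda\beta_{f_1}\cdots\beta_{f_m}I_\Lambda)<1$. (d) For every cloud $\nu\ge0$ that is carried by $\Lambda$ and satisfies $|||\nu|||\le1$ and $\nu((x))<1$ for every $x\in\Lambda$, we have $\operatorname{spr}(I_\Lambda T_\nu I_\Lambda)<1$. (d$'$) There exists a cloud $\nu\in\mathcal S_1$ that is carried by $\Lambda$ and supported on finitely many levels, such that $\operatorname{spr}(I_\Lambda T_\nu I_\Lambda)<1$. (e) For every infinite sequence $f_1,f_2,\ldots$ of functions $X\to[0,1]$ with $\operatorname{supp}(f_i)\subseteq\Lambda$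 such that $\sum_if_i=\infty$ everywhere on $\Lambda$, we have $\lim_{n\to\infty}I_\Lambda\beta_{f_1}\cdots\beta_{f_n}I_\Lambda=0$. (f) For every infinite sequence $\nu_1,\nu_2,\ldots$ of nonnegative clouds carried by $\Lambda$ and satisfying $|||\nu_i|||\le1$ and $\sum_i[1-\nu_i((x))]=\infty$ for all $x\in\Lambda$, we have $\lim_{n\to\infty}I_\Lambda T_{\nu_1}\cdots T_{\nu_n}I_\Lambda=0$.
   Context: For $f\colon X\to\mathbb R$, $I_f$ is the diagonal matrix $(I_f)_{xy}=f(x)\delta_{xy}$; $I_\Lambda=I_{\chi_\Lambda}$ with $\chi_\Lambda$ the indicator function of $\Lambda$. For $f\colon X\to[0,1]$ the cleaning operator is $\beta_f=I_{1-f}+I_f\alpha$. $\operatorname{supp}f=\{x: f(x)\ne0\}$. $\operatorname{spr}$ denotes the spectral radius; matrices of the form $I_\Lambda AI_\Lambda$ are regarded as finite matrices indexed by $\Lambda$ (the assertion $\operatorname{spr}<1$ includes the assertion that the entries are finite), and their convergence is entrywise. Products of nonnegative matrices are computed in $[0,+\infty]$ with $0\cdot\infty=0$. A marker is a nonempty finite sequence $\eta=(x_0,\ldots,x_k)$ of elements of $X$; its level is $k$. An ancestor of $\eta$ is any prefix $(x_0,\ldots,x_j)$, $0\le j\le k$; write $\sigma\preccurlyeq\eta$. A cloud is a real-valued function $\nu$ on the set of all markers; $\nu\ge0$ is pointwise. $\nu$ is supported on finitely many levels if there is $N$ with $\nu(\eta)=0$ whenever $\mathrm{level}(\eta)>N$.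 Put $|||\nu|||=\sup_\eta\sum_{\sigma\preccurlyeq\eta}|\nu(\sigma)|$ and $\widetilde\nu(\eta)=\sum_{\sigma\preccurlyeq\eta}\nu(\sigma)$. $\mathcal S_1$ is the class of clouds $\nu\ge 0$ such that $\sup_{\eta':\,\eta\preccurlyeq\eta'}\widetilde\nu(\eta')=1$ for every marker $\eta$. $\nu$ is carried by $\Lambda$ if $\nu(\eta)=0$ for every marker $\eta=(x_0,\ldots,x_k)$ having at least one index $j<k$ with $x_j\notin\Lambda$. For a nonnegative cloud $\nu$, $T_\nu$ is the matrix $(T_\nu)_{xy}=\sum\nu(\eta)\,\alpha_{x_0x_1}\cdots\alpha_{x_{k-1}x_k}\in[0,+\infty]$, summed over markers $\eta=(x_0,\ldots,x_k)$, $k\ge0$, with $x_0=x$, $x_k=y$ (empty product $=1$). *)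

(* Defs.v *)
From HB Require Import structures.
From mathcomp Require Import all_boot all_order all_algebra finmap.
From mathcomp Require Import all_classical all_reals all_analysis.
From mathcomp Require Import complex.

Set Implicit Arguments.
Unset Strict Implicit.
Unset Printing Implicit Defensive.

Import Order.TTheory GRing.Theory Num.Theory.
Import numFieldNormedType.Exports.

Local Open Scope classical_set_scope.
Local Open Scope ring_scope.

(* The largest modulus of a complex eigenvalue; it is 0 for the 0 x 0 matrix,
   which has no eigenvalue, since sup set0 = 0. *)
Definition spectral_radius (R : realType) (n : nat) (A : 'M[R]_n) : R :=
  sup [set ComplexField.Normc.normc z | z in
        [set z : R[i] | eigenvalue (map_mx (real_complex R) A) z]].

Section Matrices.
Context {R : realType} {X : countType}.

(* X-by-X matrices have entries in \bar R; all those used below have entries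
   in [0, +oo], where 0 * +oo = 0 and esum is the unconditional sum. *)
Definition emx := X -> X -> \bar R.

Definition emx_mul (A B : emx) : emx :=
  fun x y => \esum_(z in [set: X]) (A x z * B z y)%E.

Definition emx_add (A B : emx) : emx := fun x y => (A x y + B x y)%E.

Definition emx_diag (f : X -> R) : emx :=
  fun x y => (if x == y then f x else 0)%:E.

Definition emx_id : emx := emx_diag (fun=> 1).

Definition emx_of (alpha : X -> X -> R) : emx := fun x y => (alpha x y)%:E.

Definition emx_prod (m : nat) (A : nat -> emx) : emx :=
  \big[emx_mul/emx_id]_(i < m) A i.

Definition emx_ind (L : {fset X}) : emx :=
  emx_diag (fun x => if x \in L then 1 else 0).

Definition compress (L : {fset X}) (A : emx) : emx :=
  emx_mul (emx_mul (emx_ind L) A) (emx_ind L).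

(* Meaningful only when the entries of A on L are finite. *)
Definition finite_mx (L : {fset X}) (A : emx) : 'M[R]_#|{: L}| :=
  \matrix_(i, j) fine (A (val (enum_val i)) (val (enum_val j))).

Definition spr_lt1 (L : {fset X}) (A : emx) : Prop :=
  (forall x y, x \in L -> y \in L -> compress L A x y \is a fin_num) /\
  spectral_radius (finite_mx L (compress L A)) < 1.

Definition compress_cvg0 (L : {fset X}) (A : nat -> emx) : Prop :=
  forall x y, x \in L -> y \in L ->
    (fun n => compress L (A n) x y) @ \oo --> 0%E.

Definition unit_valued (f : X -> R) : Prop := forall x, 0 <= f x <= 1.

Definition supp (f : X -> R) : set X := [set x | f x != 0].

Definition cleaning (alpha : X -> X -> R) (f : X -> R) : emx :=
  emx_add (emx_diag (fun x => 1 - f x)) (emx_mul (emx_diag f) (emx_of alpha)).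

End Matrices.
Arguments emx : clear implicits.

Section Clouds.
Context {R : realType} {X : countType}.

(* (x0, [:: x1; ...; xk]) encodes the marker (x0, x1, ..., xk). *)
Definition marker := (X * seq X)%type.

Definition level (eta : marker) : nat := size eta.2.

Definition ancestors (eta : marker) : seq marker :=
  [seq (eta.1, take j eta.2) | j <- iota 0 (level eta).+1].

Definition cloud := marker -> R.

Definition cloud_ge0 (nu : cloud) : Prop := forall eta, 0 <= nu eta.

Definition finitely_many_levels (nu : cloud) : Prop :=
  exists N : nat, forall eta, (N < level eta)%N -> nu eta = 0.

Definition cloud_norm (nu : cloud) : \bar R :=
  ereal_sup (range (fun eta => (\sum_(sigma <- ancestors eta) `|nu sigma|)%:E)).

Definition cloud_tilde (nu : cloud) (eta : marker) : R :=
  \sum_(sigma <- ancestors eta) nu sigma.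

Definition cloud_S1 (nu : cloud) : Prop :=
  cloud_ge0 nu /\
  forall eta, ereal_sup [set (cloud_tilde nu eta')%:E | eta' in
                          [set eta' | eta \in ancestors eta']] = 1%E.

(* belast x0 [:: x1; ...; xk] is [:: x0; ...; x_(k-1)]. *)
Definition carried_by (L : {fset X}) (nu : cloud) : Prop :=
  forall eta, (exists2 x, x \in belast eta.1 eta.2 & x \notin L) -> nu eta = 0.

Definition path_weight (alpha : X -> X -> R) (eta : marker) : R :=
  \prod_(a <- pairmap alpha eta.1 eta.2) a.

Definition T_cloud (alpha : X -> X -> R) (nu : cloud) : emx R X :=
  fun x y =>
    \esum_(eta in [set eta : marker | eta.1 = x /\ last eta.1 eta.2 = y])
      (nu eta * path_weight alpha eta)%:E.

End Clouds.
Arguments marker : clear implicits.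
Arguments cloud : clear implicits.

(* Main.v *)
Require Import Defs.
From HB Require Import structures.
From mathcomp Require Import all_boot all_order all_algebra finmap.
From mathcomp Require Import all_classical all_reals all_analysis.
From mathcomp Require Import complex.
From mathcomp Require Import ring lra.

Set Implicit Arguments.
Unset Strict Implicit.
Unset Printing Implicit Defensive.

Import Order.TTheory GRing.Theory Num.Theory.
Import numFieldNormedType.Exports.

Local Open Scope classical_set_scope.
Local Open Scope ring_scope.

(** For a finite nonnegative matrix [B], three conditions are equivalent:
    [spectral_radius B < 1]; there is a vector [w > 0] with [B w < w]
    entrywise; and [B v <= v] implies [0 <= v] for every real vector [v]. The
    second is a certificate that can be pushed forward through constructions on
    [B], the third a maximum principle that can be pulled back, and the proof
    uses each in the direction that suits it. All the products and clouds
    considered here leave the complement of [L] aside: a row outside [L] vanishes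
    on the columns of [L], so compressing to [L] is multiplicative and only the
    action of the finite blocks on vectors over [L] matters.

    From (a): take [w > 0] with [alpha w <= c w] on [L], [0 <= c < 1]. A cleaning
    operator supported in [L], or the matrix of a cloud of norm at most [1]
    carried by [L], sends [w] below [d w + (1 - d) c w], where [d x] is the weight
    that stops at [x] at once ([1 - f x], respectively [nu((x))]). For a cloud this
    is optional stopping: as the length of the paths grows, the total of [w] over
    the weight already stopped and over the weight still moving does not
    increase, and the first step already gains the factor [c] on what moves. When
    [d < 1] on [L] this gives (b) and (d). For a product of such matrices an
    induction gives the factor [c + (1 - c) prod_i d_i x] at [x],
    which is below [1] in case (c). If [sum_i (1 - d_i x) = oo], the product
    [prod_i d_i x] tends to zero, so that the infinite sequence can be cut into
    blocks each of which contracts [w] by the factor [(1 + c) / 2]; this gives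
    (e) and (f).

    Back to (a): suppose that [alpha v <= v] on [L], with [v] of any sign. A
    cleaning operator averages [v] and [alpha v], hence does not increase [v],
    and products of cleaning operators do not either. For a cloud in [S_1] with
    finitely many levels optional stopping applies again, and the sign
    of [v] is harmless because nothing is left unstopped beyond the last level.
    So if [B] is any of the matrices in (b'), (c'), (d'), then [B v <= v], and the
    maximum principle for [B] gives [0 <= v]. In (e) and (f) the products of
    copies of [alpha] on [L] tend to zero and send [v] below [v], so again
    [0 <= v]. In every case the maximum principle holds for [alpha]. *)

(** * Spectral radius of a finite nonnegative matrix *)

Definition strict_supersolution (R : realType) (n : nat) (B : 'M[R]_n) : Prop :=
  exists w : 'cV[R]_n, forall i, 0 < w i 0 /\ (B *m w) i 0 < w i 0.

(** Nonnegativity of the inverse of [1 - B], in a form that presupposes neither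
    the existence of this inverse nor a sign of [v]. *)
Definition inverse_positive (R : realType) (n : nat) (B : 'M[R]_n) : Prop :=
  forall v : 'cV[R]_n, (forall i, (B *m v) i 0 <= v i 0) -> forall i, 0 <= v i 0.

(** If [v B = z v], the moduli satisfy [|z| |v| <= |v| B]; pairing both sides
    with the positive vector [w] leaves [|z| <= c]. *)
Lemma eigenvalue_le (R : realType) (n : nat) (B : 'M[R]_n) (w : 'cV[R]_n) (c : R)
    (z : R[i]) :
  (forall i j, 0 <= B i j) -> (forall i, 0 < w i 0) ->
  (forall i, (B *m w) i 0 <= c * w i 0) ->
  eigenvalue (map_mx (real_complex R) B) z -> ComplexField.Normc.normc z <= c.
Proof.
move=> B0 w0 Bw /eigenvalueP[v vB vn0].
pose N (x : R[i]) := ComplexField.Normc.normc x.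
have N0 x : 0 <= N x by case: x => a b; exact: sqrtr_ge0.
have NR (x : R) : N (real_complex R x) = `|x|.
  by rewrite /N /= expr0n addr0 sqrtr_sqr.
have NM (x y : R[i]) : N (x * y) = N x * N y.
  exact: ComplexField.Normc.normcM.
have Nsum (F : 'I_n -> R[i]) : N (\sum_i F i) <= \sum_i N (F i).
  elim/big_ind2: _ => [|x a y b xa yb|//].
    by rewrite [N _]ComplexField.Normc.normc0.
  exact: le_trans (le_normcD _ _) (lerD xa yb).
have key j : N z * N (v 0 j) <= \sum_i N (v 0 i) * B i j.
  rewrite -NM.
  have -> : z * v 0 j = \sum_i v 0 i * real_complex R (B i j).
    have := congr1 (fun A : 'rV_n => A 0 j) vB; rewrite !mxE => <-.
    by apply: eq_bigr => i _; rewrite mxE.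
  apply: (le_trans (Nsum _)); apply: ler_sum => i _.
  by rewrite NM NR ger0_norm.
pose m := \sum_j N (v 0 j) * w j 0.
have m0 : 0 < m.
  have /existsP[j vj] : [exists j, v 0 j != 0].
    apply: contraNT vn0 => /existsPn v0; apply/eqP/rowP => j.
    by rewrite mxE; apply/eqP; rewrite -[_ == _]negbK v0.
  rewrite /m (bigD1 j)//=; apply: ltr_pwDl.
    rewrite mulr_gt0// lt0r N0 andbT; apply: contraNneq vj.
    by move=> /ComplexField.Normc.eq0_normc ->.
  by apply: sumr_ge0 => i _; rewrite mulr_ge0// ltW.
rewrite -(ler_pM2r m0) {1}/m mulr_sumr.
have -> : c * m = \sum_i N (v 0 i) * (c * w i 0).
  by rewrite /m mulr_sumr; apply: eq_bigr => i _; ring.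
apply: (@le_trans _ _ (\sum_i N (v 0 i) * (B *m w) i 0)); last first.
  by apply: ler_sum => i _; rewrite ler_wpM2l.
apply: (@le_trans _ _ (\sum_j (\sum_i N (v 0 i) * B i j) * w j 0)).
  by apply: ler_sum => j _; rewrite mulrA ler_wpM2r// ltW.
rewrite le_eqVlt; apply/orP; left; apply/eqP.
under eq_bigr do rewrite mulr_suml.
rewrite exchange_big /=; apply: eq_bigr => i _.
by rewrite mxE mulr_sumr; apply: eq_bigr => j _; rewrite mulrA.
Qed.

(** As there are finitely many indices, [B w < w] improves to [B w <= c w] with
    [c < 1], which is needed to bound a supremum strictly. *)
Lemma spectral_radius_lt1 (R : realType) (n : nat) (B : 'M[R]_n) :
  (forall i j, 0 <= B i j) -> strict_supersolution B -> spectral_radius B < 1.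
Proof.
move=> B0 [w wP].
have [c [c0 c1 Bw]] : exists c : R,
    [/\ 0 <= c, c < 1 & forall i, (B *m w) i 0 <= c * w i 0].
  exists (\big[Order.max/0]_i ((B *m w) i 0 / w i 0)).
  split=> [||i]; first exact: bigmax_ge_id.
    apply/bigmax_ltP; split=> // i _.
    by have [wi Bwi] := wP i; rewrite ltr_pdivrMr// mul1r.
  have [wi _] := wP i; rewrite -ler_pdivrMr//.
  exact: (le_bigmax _ (fun i => (B *m w) i 0 / w i 0)).
rewrite /spectral_radius; set E := (X in sup X).
have [->|/set0P En0] := eqVneq E set0; first by rewrite sup0.
apply: (le_lt_trans _ c1); apply: ge_sup => // _ [z zB <-].
by apply: eigenvalue_le zB => // i; have [] := wP i.
Qed.

(** The supremum defining the spectral radius is over a bounded set: the vector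
    of ones shows that every eigenvalue is at most the sum of all the entries. *)
Lemma eigenvalue_le_spectral_radius (R : realType) (n : nat) (B : 'M[R]_n) (z : R[i]) :
  (forall i j, 0 <= B i j) ->
  eigenvalue (map_mx (real_complex R) B) z ->
  ComplexField.Normc.normc z <= spectral_radius B.
Proof.
move=> B0 zB; apply: ub_le_sup; last by exists z.
exists (\sum_i \sum_j B i j) => _ [u uB <-].
apply: (@eigenvalue_le _ _ B (const_mx 1)) uB => // i; first by rewrite mxE.
have -> : (B *m const_mx 1) i (0 : 'I_1) = \sum_j B i j.
  by rewrite mxE; apply: eq_bigr => j _; rewrite mxE mulr1.
rewrite mxE mulr1 [leRHS](bigD1 i)//=.
by rewrite lerDl sumr_ge0// => k _; exact: sumr_ge0.
Qed.

(** A singular [1 - t B] would make [1/t >= 1] an eigenvalue of [B]. *)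
Lemma det_sub_scale_neq0 (R : realType) (n : nat) (B : 'M[R]_n) (t : R) :
  (forall i j, 0 <= B i j) -> spectral_radius B < 1 -> 0 <= t <= 1 ->
  \det (1%:M - t *: B) != 0.
Proof.
move=> B0 sB /andP[t0 t1]; apply/negP => /det0P[v vn0].
rewrite mulmxBr mulmx1 -scalemxAr => /subr0_eq vtB.
have tn0 : t != 0.
  by apply: contraNneq vn0 => t00; rewrite vtB t00 scale0r.
have tp : 0 < t by rewrite lt0r tn0.
have eB : eigenvalue B t^-1.
  by apply/eigenvalueP; exists v => //; rewrite {2}vtB scalerA mulVf// scale1r.
rewrite -(eigenvalue_map (real_complex R)) in eB.
have := eigenvalue_le_spectral_radius B0 eB.
rewrite /ComplexField.Normc.normc /= expr0n addr0 sqrtr_sqr gtr0_norm ?invr_gt0//.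
by move=> /le_lt_trans/(_ sB); rewrite invf_lt1// ltNge t1.
Qed.

(** The vector [w t = (1 - t B)^-1 1] is defined for [t] in [0, 1] and continuous,
    and [w 0 = 1]. Since [w t = 1 + t B (w t)], wherever [w t] is nonnegative it
    is at least [1]; so the set of such [t] is both open and closed in the
    interval, hence everything, and [w 1] is the vector sought. Cramer's rule
    makes the entries of [w t] quotients [p i / q] of polynomials in [t]; their
    sign is that of the polynomial [p i * q], to which continuity is applied. *)
Lemma spectral_radius_strict_supersolution (R : realType) (n : nat) (B : 'M[R]_n) :
  (forall i j, 0 <= B i j) -> spectral_radius B < 1 -> strict_supersolution B.
Proof.
move=> B0 sB.
pose P : 'M[{poly R}]_n := 1%:M - 'X *: map_mx polyC B.
have PE t : map_mx (horner_eval t) P = 1%:M - t *: B.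
  apply/matrixP => i j; rewrite !mxE /horner_eval hornerD hornerN hornerMn.
  by rewrite hornerM hornerX !hornerC.
pose q := \det P.
have qE t : q.[t] = \det (1%:M - t *: B).
  by rewrite -PE det_map_mx.
pose p i : {poly R} := (\adj P *m const_mx 1) i (0 : 'I_1).
have pE t i : (p i).[t] = (\adj (1%:M - t *: B) *m const_mx 1) i (0 : 'I_1).
  rewrite -PE -map_mx_adj /p !mxE horner_sum; apply: eq_bigr => j _.
  by rewrite !mxE mulr1 mulr1.
pose w t : 'cV[R]_n := \col_i ((p i).[t] / q.[t]).
have wE (t : R) : 0 <= t <= 1 -> forall i, w t i 0 = 1 + t * (B *m w t) i 0.
  move=> t01; have qn0 := det_sub_scale_neq0 B0 sB t01.
  have weq : w t = (q.[t])^-1 *: (\adj (1%:M - t *: B) *m const_mx 1).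
    by apply/matrixP => i j; rewrite (ord1 j) [LHS]mxE [RHS]mxE pE mulrC.
  have : (1%:M - t *: B) *m w t = const_mx 1.
    rewrite weq -scalemxAr mulmxA mul_mx_adj qE mul_scalar_mx scalerA mulVf//.
    by rewrite scale1r.
  rewrite mulmxBl mul1mx -scalemxAl => /matrixP e i.
  by have := e i 0; rewrite !mxE => <-; rewrite subrK.
have wpos (t : R) : 0 <= t <= 1 -> (forall i, 0 <= w t i 0) -> forall i, 1 <= w t i 0.
  move=> t01 wt i; rewrite wE// lerDl mulr_ge0//; first by case/andP: t01.
  by rewrite mxE sumr_ge0// => j _; rewrite mulr_ge0.
have uE (t : R) i : 0 <= t <= 1 -> (p i * q).[t] = q.[t] ^+ 2 * w t i 0.
  move=> t01; have := det_sub_scale_neq0 B0 sB t01; rewrite -qE => qn0.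
  by rewrite mxE hornerM; field.
have q2 (t : R) : 0 <= t <= 1 -> 0 < q.[t] ^+ 2.
  move=> t01; have := det_sub_scale_neq0 B0 sB t01; rewrite -qE => qn0.
  by rewrite exprn_even_gt0.
pose S := [set` `[(0 : R), 1]] `&` [set t | forall i, 0 <= (p i * q).[t]].
have SE : S = [set` `[(0 : R), 1]].
  apply: (@segment_connected R 0 1).
  - exists 0; split; first by rewrite /= in_itv /= lexx ler01.
    have t01 : 0 <= (0 : R) <= 1 by rewrite lexx ler01.
    by move=> i; rewrite uE// mulr_ge0 ?(ltW (q2 _ _))// wE// mul0r addr0.
  - exists [set t | forall i, 0 < (p i * q).[t]].
      have -> : [set t | forall i, 0 < (p i * q).[t]] =
                ~` \bigcup_(i in [set: 'I_n]) (horner (p i * q) @^-1` [set t | t <= 0]).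
        apply/seteqP; split=> t /=.
          by move=> h [i _ /=]; rewrite leNgt h.
        by move=> h i; rewrite ltNge; apply/negP => pi; apply: h; exists i.
      rewrite openC; apply: closed_bigcup; first exact: finite_finset.
      move=> i _; apply: closed_comp; last exact: closed_le.
      by move=> t _; exact: continuous_horner.
    apply/seteqP; split=> t [/= t01 h]; split=> // i; last exact: ltW.
    rewrite in_itv /= in t01.
    rewrite uE// mulr_gt0 ?q2//; apply: (lt_le_trans ltr01); apply: wpos => // j.
    by have := h j; rewrite uE// pmulr_rge0// q2.
  - exists [set t | forall i, 0 <= (p i * q).[t]] => //.
    have -> : [set t | forall i, 0 <= (p i * q).[t]] =
              \bigcap_(i in [set: 'I_n]) (horner (p i * q) @^-1` [set t | 0 <= t]).
      by apply/seteqP; split=> t /= h i; [move=> _|]; exact: h.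
    apply: closed_bigI => i _; apply: closed_comp; last exact: closed_ge.
    by move=> t _; exact: continuous_horner.
have t01 : 0 <= (1 : R) <= 1 by rewrite lexx ler01.
have w1 : forall i, 1 <= w 1 i 0.
  apply: wpos => // i.
  have : S 1 by rewrite SE /= in_itv.
  by move=> [_ /(_ i)]; rewrite uE// pmulr_rge0// q2.
exists (w 1) => i; split; first exact: lt_le_trans (w1 i).
by rewrite [ltRHS]wE// mul1r ltrDr.
Qed.

(** Maximum principle: if [m = min_i v i / w i] were negative and attained at
    [i], then [v >= m w] would give [m w i = v i >= (B v) i >= m (B w) i], that is
    [w i <= (B w) i]. *)
Lemma strict_supersolution_inverse_positive (R : realType) (n : nat) (B : 'M[R]_n) :
  (forall i j, 0 <= B i j) -> strict_supersolution B -> inverse_positive B.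
Proof.
move=> B0 [w wP] v Bv k.
have w0 i : 0 < w i 0 by have [] := wP i.
case: (arg_minP (fun i => v i 0 / w i 0) (erefl (xpredT k))) => i _ imin.
set m := v i 0 / w i 0 in imin *.
suff m0 : 0 <= m.
  by have := imin k isT; move=> /(le_trans m0); rewrite pmulr_lge0// invr_gt0.
rewrite leNgt; apply/negP => m0.
have vi : v i 0 = m * w i 0 by rewrite /m divfK// gt_eqF.
have : m * (B *m w) i 0 <= (B *m v) i 0.
  rewrite !mxE mulr_sumr; apply: ler_sum => j _; rewrite mulrCA ler_wpM2l//.
  by rewrite -ler_pdivlMr// imin.
move=> /le_trans/(_ (Bv i)); rewrite vi ler_nM2l// leNgt.
by have [_ ->] := wP i.
Qed.

(** A vector fixed by [B] is nonnegative, and so is its opposite; hence it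
    vanishes and [1 - B] is invertible. The solution of [w = 1 + B w] is then nonnegative,
    hence at least [1]. *)
Lemma inverse_positive_strict_supersolution (R : realType) (n : nat) (B : 'M[R]_n) :
  (forall i j, 0 <= B i j) -> inverse_positive B -> strict_supersolution B.
Proof.
move=> B0 M.
have U : (1%:M - B)^T \in unitmx.
  rewrite unitmxE unitfE; apply/negP => /det0P[u un0 u0].
  have Bu : B *m u^T = u^T.
    have := congr1 trmx u0; rewrite trmx_mul trmxK trmx0 mulmxBl mul1mx.
    by move/subr0_eq.
  have u_ge0 : forall i, 0 <= u^T i 0 by apply: M => i; rewrite Bu.
  have u_le0 : forall i, 0 <= (- u^T) i 0 by apply: M => i; rewrite mulmxN Bu.
  case/negP: un0; apply/eqP/rowP => i; apply/eqP; rewrite eq_le.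
  have := u_ge0 i; have := u_le0 i; rewrite !mxE oppr_ge0.
  by move=> -> ->.
rewrite unitmx_tr in U.
pose w : 'cV[R]_n := invmx (1%:M - B) *m const_mx 1.
have wE : forall i, w i 0 = 1 + (B *m w) i 0.
  have : (1%:M - B) *m w = const_mx 1 by rewrite /w mulmxA mulmxV// mul1mx.
  rewrite mulmxBl mul1mx => /matrixP e i.
  have := e i 0; rewrite [LHS]mxE [X in _ + X]mxE [RHS]mxE => <-.
  by rewrite subrK.
have w0 : forall i, 0 <= w i 0 by apply: M => i; rewrite [leRHS]wE lerDr.
exists w => i; split; last by rewrite [ltRHS]wE ltrDr.
rewrite wE ltr_wpDr// mxE sumr_ge0// => j _; exact: mulr_ge0.
Qed.

(** * Extended matrices that reduce to a finite index set *)

Lemma esum_fset_supported (R : realType) (X : choiceType) (L : {fset X}) (a : X -> \bar R) :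
  (forall z, (0 <= a z)%E) -> (forall z, z \notin L -> a z = 0%E) ->
  \esum_(z in [set: X]) a z = (\sum_(z <- L) a z)%E.
Proof.
move=> a0 aL; transitivity (\esum_(z in [set` L]) a z).
  rewrite [RHS]esum_mkcond; apply: eq_esum => z _; case: ifPn => //.
  by rewrite notin_setE /= => /negP/aL.
by rewrite esum_fset// [RHS]fsbig_seq// fset_uniq.
Qed.

(** Vectors stay functions on all of [X], so that products of blocks on [L] need
    no reindexing. *)
Definition act (R : realType) (X : countType) (L : {fset X}) (A : emx R X)
  (v : X -> R) (x : X) : R := \sum_(y <- L) fine (A x y) * v y.

(** The vanishing of the rows outside [L] on the columns of [L] makes paths
    that leave [L] unable to come back, so that compression to [L] commutes with
    products. Entries in the columns outside [L] may be infinite. *)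
Definition localized (R : realType) (X : countType) (L : {fset X}) (A : emx R X) : Prop :=
  [/\ forall x y, (0 <= A x y)%E,
      forall x y, x \notin L -> y \in L -> A x y = 0%E &
      forall x y, x \in L -> y \in L -> A x y \is a fin_num].

Section Localized.
Context {R : realType} {X : countType} (L : {fset X}).
Implicit Types (A B : emx R X) (v w : X -> R).

Lemma emx_mul_diagl (f : X -> R) A x y :
  (forall x, 0 <= f x) -> (forall x y, (0 <= A x y)%E) ->
  emx_mul (emx_diag f) A x y = ((f x)%:E * A x y)%E.
Proof.
move=> f0 A0; rewrite /emx_mul (esum_fset_supported (L := [fset x]%fset)).
- by rewrite big_seq_fset1 /emx_diag eqxx.
- by move=> z; rewrite mule_ge0// /emx_diag lee_fin; case: ifP.
- move=> z; rewrite inE => zx.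
  by rewrite /emx_diag eq_sym (negbTE zx) mul0e.
Qed.

Lemma emx_mul_indl A x y : (forall x y, (0 <= A x y)%E) -> x \in L ->
  emx_mul (emx_ind L) A x y = A x y.
Proof.
move=> A0 xL; rewrite emx_mul_diagl//; first by rewrite xL mul1e.
by move=> z; case: ifP.
Qed.

Lemma compressE A x y : (forall x y, (0 <= A x y)%E) -> x \in L -> y \in L ->
  compress L A x y = A x y.
Proof.
move=> A0 xL yL.
rewrite /compress /emx_mul (esum_fset_supported (L := [fset y]%fset)).
- rewrite big_seq_fset1 -/(emx_mul (emx_ind L) A x y) emx_mul_indl//.
  by rewrite /emx_ind /emx_diag eqxx yL mule1.
- move=> z; rewrite mule_ge0//; last first.
    rewrite /emx_ind /emx_diag lee_fin.
    by case: ifP => // _; case: ifP.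
  by rewrite -/(emx_mul (emx_ind L) A x z) emx_mul_indl.
- move=> z; rewrite inE => zy.
  by rewrite /emx_ind /emx_diag (negbTE zy) mule0.
Qed.

Lemma big_fset_ord (F : X -> R) :
  \sum_(y <- L) F y = \sum_(i < #|{: L}|) F (val (enum_val i)).
Proof.
rewrite big_seq_fsetE /= (reindex (fun i : 'I_#|{: L}| => enum_val i))//=.
exists enum_rank => u _; [exact: enum_valK|exact: enum_rankK].
Qed.

Definition col_of v : 'cV[R]_#|{: L}| := \col_i v (val (enum_val i)).

Definition of_col (u : 'cV[R]_#|{: L}|) : X -> R :=
  fun x => if insub x is Some x' then u (enum_rank (x' : L)) 0 else 0.

Lemma of_colE (u : 'cV[R]_#|{: L}|) i : of_col u (val (enum_val i)) = u i 0.
Proof. by rewrite /of_col valK enum_valK. Qed.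

Lemma col_ofK u : col_of (of_col u) = u.
Proof. by apply/matrixP => i j; rewrite (ord1 j) mxE of_colE. Qed.

Lemma enum_val_fset x : x \in L -> exists i : 'I_#|{: L}|, val (enum_val i) = x.
Proof. by move=> xL; exists (enum_rank [` xL]%fset); rewrite enum_rankK. Qed.

Lemma finite_mx_act A v i : (forall x y, (0 <= A x y)%E) ->
  (finite_mx L (compress L A) *m col_of v) i 0 = act L A v (val (enum_val i)).
Proof.
move=> A0; rewrite mxE /act big_fset_ord; apply: eq_bigr => j _.
by rewrite !mxE compressE// ?fsvalP.
Qed.

Lemma spr_lt1_strict_supersolution A : (forall x y, (0 <= A x y)%E) ->
  (forall x y, x \in L -> y \in L -> A x y \is a fin_num) ->
  spr_lt1 L A <-> exists w, forall x, x \in L -> 0 < w x /\ act L A w x < w x.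
Proof.
move=> A0 Afin; pose B := finite_mx L (compress L A).
have B0 i j : 0 <= B i j by rewrite mxE compressE ?fsvalP// fine_ge0.
split=> [[_ /(spectral_radius_strict_supersolution B0)[u uP]]|[w wP]].
  exists (of_col u) => x /enum_val_fset[i <-]; rewrite of_colE -finite_mx_act//.
  by rewrite col_ofK.
split=> [x y xL yL|]; first by rewrite compressE// Afin.
apply: spectral_radius_lt1 => //; exists (col_of w) => i.
by rewrite finite_mx_act// mxE; apply: wP; exact: fsvalP.
Qed.

Lemma spr_lt1_inverse_positive A : (forall x y, (0 <= A x y)%E) ->
  (forall x y, x \in L -> y \in L -> A x y \is a fin_num) ->
  spr_lt1 L A <->
  forall v, (forall x, x \in L -> act L A v x <= v x) -> forall x, x \in L -> 0 <= v x.
Proof.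
move=> A0 Afin; pose B := finite_mx L (compress L A).
have B0 i j : 0 <= B i j by rewrite mxE compressE ?fsvalP// fine_ge0.
split=> [[_ /(spectral_radius_strict_supersolution B0)]|M].
  move=> /(strict_supersolution_inverse_positive B0) M v vP x /enum_val_fset[i <-].
  have -> : v (val (enum_val i)) = col_of v i 0 by rewrite mxE.
  apply: M => j; rewrite finite_mx_act// mxE; apply: vP; exact: fsvalP.
split=> [x y xL yL|]; first by rewrite compressE// Afin.
apply: spectral_radius_lt1 => //; apply: inverse_positive_strict_supersolution => // u uP i.
rewrite -of_colE; apply: M; last exact: fsvalP.
move=> x /enum_val_fset[j <-]; rewrite of_colE -finite_mx_act// col_ofK.
exact: uP.
Qed.

Lemma le_act A v w x : (forall x y, (0 <= A x y)%E) ->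
  (forall y, y \in L -> v y <= w y) -> act L A v x <= act L A w x.
Proof.
move=> A0 vw; rewrite /act big_seq [leRHS]big_seq; apply: ler_sum => y yL.
by rewrite ler_wpM2l ?fine_ge0 ?vw.
Qed.

Lemma eq_act A v w x : (forall y, y \in L -> v y = w y) -> act L A v x = act L A w x.
Proof. by move=> vw; apply: eq_big_seq => y yL; rewrite vw. Qed.

Lemma actZ A (c : R) v x : act L A (fun y => c * v y) x = c * act L A v x.
Proof. by rewrite /act mulr_sumr; apply: eq_bigr => y _; rewrite mulrCA. Qed.

(** For the terms with [z] outside [L] the second factor is zero, whatever the
    (possibly infinite) first one. *)
Lemma emx_mul_localized A B x y : localized L A -> localized L B ->
  x \in L -> y \in L ->
  emx_mul A B x y = (\sum_(z <- L) fine (A x z) * fine (B z y))%:E.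
Proof.
move=> [A0 Al Af] [B0 Bl Bf] xL yL.
rewrite /emx_mul (esum_fset_supported (L := L)); last first.
- by move=> z zL; rewrite Bl// mule0.
- by move=> z; exact: mule_ge0.
rewrite -sumEFin big_seq [RHS]big_seq; apply: eq_bigr => z zL.
by rewrite EFinM !fineK ?Af ?Bf.
Qed.

Lemma localized_mul A B : localized L A -> localized L B -> localized L (emx_mul A B).
Proof.
move=> lA lB; have [A0 Al Af] := lA; have [B0 Bl Bf] := lB; split.
- by move=> x y; apply: esum_ge0 => z _; exact: mule_ge0.
- move=> x y xL yL; apply: esum1 => z _.
  have [zL|zL] := boolP (z \in L); first by rewrite Al// mul0e.
  by rewrite Bl// mule0.
- by move=> x y xL yL; rewrite emx_mul_localized.
Qed.

Lemma act_mul A B v x : localized L A -> localized L B -> x \in L ->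
  act L (emx_mul A B) v x = act L A (act L B v) x.
Proof.
move=> lA lB xL; rewrite /act.
rewrite (eq_big_seq (fun y => \sum_(z <- L) fine (A x z) * fine (B z y) * v y)).
  rewrite exchange_big /=; apply: eq_bigr => z _; rewrite mulr_sumr.
  by apply: eq_bigr => y _; rewrite mulrA.
by move=> y yL; rewrite emx_mul_localized//= mulr_suml.
Qed.

Lemma localized_id : localized L (emx_id : emx R X).
Proof.
split=> [x y|x y xL yL|x y _ _] //.
  by rewrite /emx_id /emx_diag lee_fin; case: ifP.
rewrite /emx_id /emx_diag; case: eqP => // xy.
by rewrite xy yL in xL.
Qed.

Lemma act_diag (f : X -> R) v x : x \in L -> act L (emx_diag f) v x = f x * v x.
Proof.
move=> xL; rewrite /act (big_fsetD1 x)//= /emx_diag eqxx /= big_seq big1 ?addr0// => y.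
by rewrite !inE eq_sym => /andP[/negbTE -> _]; rewrite mul0r.
Qed.

Lemma act_id v x : x \in L -> act L emx_id v x = v x.
Proof. by move=> xL; rewrite act_diag// mul1r. Qed.

Lemma emx_prodS (n : nat) (A : nat -> emx R X) :
  emx_prod n.+1 A = emx_mul (A 0) (emx_prod n (fun i => A i.+1)).
Proof. by rewrite /emx_prod big_ord_recl. Qed.

Lemma localized_prod (n : nat) (A : nat -> emx R X) :
  (forall i, (i < n)%N -> localized L (A i)) -> localized L (emx_prod n A).
Proof.
elim: n A => [|n IH] A lA.
  by rewrite /emx_prod big_ord0; exact: localized_id.
rewrite emx_prodS; apply: localized_mul; first exact: lA.
by apply: IH => i ni; exact: lA.
Qed.

Lemma act_prodS (n : nat) (A : nat -> emx R X) v x :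
  (forall i, (i < n.+1)%N -> localized L (A i)) -> x \in L ->
  act L (emx_prod n.+1 A) v x = act L (A 0) (act L (emx_prod n (fun i => A i.+1)) v) x.
Proof.
move=> lA xL; rewrite emx_prodS act_mul//; first exact: lA.
by apply: localized_prod => i ni; exact: lA.
Qed.

Lemma act_prod0 (A : nat -> emx R X) v x : x \in L -> act L (emx_prod 0 A) v x = v x.
Proof. by move=> xL; rewrite /emx_prod big_ord0 act_id. Qed.

Lemma act_prodD (n m : nat) (A : nat -> emx R X) v x :
  (forall i, localized L (A i)) -> x \in L ->
  act L (emx_prod (n + m) A) v x =
  act L (emx_prod n A) (act L (emx_prod m (fun i => A (n + i)%N)) v) x.
Proof.
elim: n A x => [|n IH] A x lA xL; first by rewrite act_prod0.
rewrite addSn !act_prodS//; apply: eq_act => y yL.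
by rewrite IH.
Qed.

Lemma act_prod_le (n : nat) (A : nat -> emx R X) v :
  (forall i, (i < n)%N -> localized L (A i)) ->
  (forall i, (i < n)%N -> forall x, x \in L -> act L (A i) v x <= v x) ->
  forall x, x \in L -> act L (emx_prod n A) v x <= v x.
Proof.
elim: n A => [|n IH] A lA Av x xL; first by rewrite act_prod0.
rewrite act_prodS//; apply: (le_trans _ (Av 0 isT x xL)).
apply: le_act => [y z|]; first by have [] := lA 0%N isT.
by apply: IH => i ni; [exact: lA|exact: Av].
Qed.

End Localized.

(** * Products of lazy matrices *)

(** This is [d <= 1 / (1 + (1 - d))] multiplied over [i], together with
    [1 + sum_i a_i <= prod_i (1 + a_i)]; it turns divergence of [sum (1 - d_i)]
    into convergence of [prod d_i] to zero without logarithms. *)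
Lemma prod_le_inv_sum (R : realFieldType) (n : nat) (d : nat -> R) :
  (forall i, 0 <= d i <= 1) ->
  \prod_(i < n) d i * (1 + \sum_(i < n) (1 - d i)) <= 1.
Proof.
move=> d01; elim: n => [|n IH]; first by rewrite !big_ord0 addr0 mulr1.
rewrite !big_ord_recr /=; set P := \prod_(i < n) _ in IH *.
set S := \sum_(i < n) _ in IH *.
have P0 : 0 <= P by apply: prodr_ge0 => i _; case/andP: (d01 i).
have S0 : 0 <= S by apply: sumr_ge0 => i _; rewrite subr_ge0; case/andP: (d01 i).
apply: le_trans IH; rewrite -mulrA ler_wpM2l//.
have /andP[d0 d1] := d01 n.
suff : 0 <= (1 - d n) * (1 - d n + S) by lra.
by apply: mulr_ge0; lra.
Qed.

(** Otherwise all partial sums would be at most [k + 1]. *)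
Lemma tail_sum_ge1 (R : realType) (a : nat -> R) (k : nat) :
  (forall i, 0 <= a i <= 1) -> (\sum_(0 <= i <oo) (a i)%:E = +oo)%E ->
  exists n, 1 <= \sum_(i < n) a (k + i)%N.
Proof.
move=> a01 aoo; apply: contrapT => /forallNP h.
have a0 i : 0 <= a i by case/andP: (a01 i).
have : (\sum_(0 <= i <oo) (a i)%:E <= (k.+1%:R : R)%:E)%E.
  apply: lime_le; first by apply: is_cvg_nneseries => i _ _; rewrite lee_fin.
  apply: nearW => n; rewrite sumEFin lee_fin big_mkord.
  apply: (@le_trans _ _ (\sum_(i < k + n) a i)).
    rewrite addnC big_split_ord /= lerDl; exact: sumr_ge0.
  rewrite big_split_ord /= -natr1 lerD//; last first.
    by rewrite ltW// ltNge; apply/negP/h.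
  rewrite -[X in _ <= X%:R]card_ord -sumr_const; apply: ler_sum => i _.
  by case/andP: (a01 i).
by rewrite aoo leye_eq.
Qed.

Lemma tail_prod_le_half (R : realType) (d : nat -> R) (k : nat) :
  (forall i, 0 <= d i <= 1) -> (\sum_(0 <= i <oo) (1 - d i)%:E = +oo)%E ->
  exists n, \prod_(i < n) d (k + i)%N <= 2^-1.
Proof.
move=> d01 doo.
have [|n nP] := @tail_sum_ge1 R (fun i => 1 - d i) k _ doo.
  by move=> i; have /andP[d0 d1] := d01 i; apply/andP; split; lra.
exists n; have := @prod_le_inv_sum R n (fun i => d (k + i)%N) (fun i => d01 _).
set P := \prod_(i < n) _; have P0 : 0 <= P.
  by apply: prodr_ge0 => i _; case/andP: (d01 (k + i)%N).
by nra.
Qed.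

Section Lazy.
Context {R : realType} {X : countType} (L : {fset X}).
Implicit Types (A : emx R X) (w : X -> R).

(** A lower bound [d x] on the diagonal, the rest of the row contracting [w] by
    the factor [c] as if it had the weight [1 - d x]. *)
Definition lazy (c : R) (w d : X -> R) A : Prop := forall x, x \in L ->
  [/\ 0 <= d x <= 1, d x <= fine (A x x) &
      act L A w x <= d x * w x + (1 - d x) * (c * w x)].

(** Replacing [w] by the smaller [u] saves at least the diagonal share of the
    gap at [x]. *)
Lemma act_diag_gap A (d : R) (u w : X -> R) x :
  (forall x y, (0 <= A x y)%E) -> x \in L ->
  (forall y, y \in L -> u y <= w y) -> d <= fine (A x x) ->
  act L A u x + d * (w x - u x) <= act L A w x.
Proof.
move=> A0 xL uw dA; rewrite -lerBrDl /act -sumrB.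
rewrite (big_fsetD1 x)//= -mulrBr ler_wpDr//; last first.
  by rewrite ler_wpM2r// subr_ge0 uw.
rewrite big_seq; apply: sumr_ge0 => y; rewrite !inE => /andP[_ yL].
by rewrite -mulrBr mulr_ge0 ?fine_ge0// subr_ge0 uw.
Qed.

(** Peel off the leftmost factor. The rest of the product maps [w] to some
    [u <= w]; the improvement of [u] over [w] at the point [x] itself is kept with
    weight [d 0 x], and elsewhere only [u <= w] is used. Hence the excess over [c]
    of the ratio of the image to [w] at [x] is multiplied by [d 0 x]. *)
Lemma lazy_prod (c : R) w (n : nat) (A : nat -> emx R X) (d : nat -> X -> R) :
  0 <= c <= 1 -> (forall x, x \in L -> 0 < w x) ->
  (forall i, (i < n)%N -> localized L (A i)) ->
  (forall i, (i < n)%N -> lazy c w (d i) (A i)) ->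
  forall x, x \in L ->
  act L (emx_prod n A) w x <= (c + (1 - c) * \prod_(i < n) d i x) * w x.
Proof.
move=> /andP[c0 c1] w0; elim: n A d => [|n IH] A d lA zA x xL.
  by rewrite act_prod0// big_ord0 mulr1 subrKC mul1r.
have [A0 _ _] := lA 0 isT; have [/andP[d0 d1] dA Aw] := zA 0 isT x xL.
rewrite act_prodS//; set u := act L _ w.
have {IH} uP y : y \in L ->
    u y <= (c + (1 - c) * \prod_(i < n) d i.+1 y) * w y.
  by apply: (IH _ (fun i => d i.+1)) => // i ni; [exact: lA|exact: zA].
have uw y : y \in L -> u y <= w y.
  move=> yL; apply: (le_trans (uP y yL)); rewrite (ler_piMl (ltW (w0 y yL)))//.
  rewrite -lerBrDl -[leRHS]mulr1 ler_wpM2l ?subr_ge0//.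
  apply: Num.Theory.prodr_ile1 => i _.
  by have [] := zA i.+1 (ltn_ord i) y yL.
have := act_diag_gap A0 xL uw dA; rewrite big_ord_recl.
set P := \prod_(i < n) _ in uP *; have ux := uP x xL; have wx := w0 x xL.
rewrite -lerBrDr => /le_trans; apply.
rewrite lerBlDr; apply: (le_trans Aw).
have : d 0 x * u x <= d 0 x * ((c + (1 - c) * \prod_(i < n) d i.+1 x) * w x).
  by rewrite ler_wpM2l.
move=> h; rewrite -subr_ge0; rewrite -subr_ge0 in h; apply: le_trans h _.
rewrite le_eqVlt; apply/orP; left; apply/eqP; rewrite /P /=.
by under [in RHS]eq_bigr do rewrite /bump /=; ring.
Qed.

(** Enough factors, counted from any starting point [k], push all the products
    [prod_i d_i x], for [x] in the finite set [L], below [1/2]. *)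
Lemma lazy_block (c : R) w (A : nat -> emx R X) (d : nat -> X -> R) (k : nat) :
  0 <= c <= 1 -> (forall x, x \in L -> 0 < w x) ->
  (forall i, localized L (A i)) -> (forall i, lazy c w (d i) (A i)) ->
  (forall x, x \in L -> (\sum_(0 <= i <oo) (1 - d i x)%:E = +oo)%E) ->
  exists n, forall x, x \in L ->
    act L (emx_prod n (fun i => A (k + i)%N)) w x <= (c + (1 - c) / 2) * w x.
Proof.
move=> c01 w0 lA zA doo; have /andP[c0 c1] := c01.
have d01 x i : x \in L -> 0 <= d i x <= 1 by move=> xL; have [] := zA i x xL.
suff [n nP] : exists n, forall x, x \in L -> \prod_(i < n) d (k + i)%N x <= 2^-1.
  exists n => x xL; apply: (@le_trans _ _
    ((c + (1 - c) * \prod_(i < n) d (k + i)%N x) * w x)).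
    by apply: (@lazy_prod c w n (fun i => A (k + i)%N) (fun i => d (k + i)%N)).
  by rewrite ler_pM2r ?w0// lerD2l ler_wpM2l ?subr_ge0// nP.
(* finitely many points: a common [n] is found by induction on a list of them *)
suff : forall s : seq X, {subset s <= L} ->
    exists n, forall x, x \in s -> \prod_(i < n) d (k + i)%N x <= 2^-1.
  by apply.
have mono x n m : x \in L -> (n <= m)%N ->
    \prod_(i < m) d (k + i)%N x <= \prod_(i < n) d (k + i)%N x.
  move=> xL /subnKC <-; rewrite big_split_ord /= ler_piMr//.
    by apply: prodr_ge0 => i _; case/andP: (d01 x (k + i)%N xL).
  by apply: Num.Theory.prodr_ile1 => i _; exact: d01.
elim=> [|y s IH] sL; first by exists 0%N.
have [|n nP] := IH; first by move=> z zs; apply: sL; rewrite inE zs orbT.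
have yL : y \in L by apply: sL; rewrite inE eqxx.
have [m mP] := @tail_prod_le_half R (fun i => d i y) k (fun i => d01 y i yL) (doo y yL).
exists (maxn n m) => x; rewrite inE => /orP[/eqP ->|xs].
  by apply: le_trans (mono _ _ _ yL (leq_maxr n m)) mP.
apply: le_trans (mono _ _ _ _ (leq_maxl n m)) (nP x xs).
by apply: sL; rewrite inE xs orbT.
Qed.

Lemma lazy_power (c : R) w (A : nat -> emx R X) (d : nat -> X -> R) (j k : nat) :
  0 <= c <= 1 -> (forall x, x \in L -> 0 < w x) ->
  (forall i, localized L (A i)) -> (forall i, lazy c w (d i) (A i)) ->
  (forall x, x \in L -> (\sum_(0 <= i <oo) (1 - d i x)%:E = +oo)%E) ->
  exists n, forall x, x \in L ->
    act L (emx_prod n (fun i => A (k + i)%N)) w x <= (c + (1 - c) / 2) ^+ j * w x.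
Proof.
move=> c01 w0 lA zA doo; have /andP[c0 c1] := c01.
elim: j k => [|j IH] k.
  by exists 0%N => x xL; rewrite act_prod0// expr0 mul1r.
have [n nP] := lazy_block k c01 w0 lA zA doo.
have [m mP] := IH (k + n)%N.
exists (n + m)%N => x xL; rewrite act_prodD//.
set q := c + _ in nP mP *.
have q0 : 0 <= q by rewrite /q; lra.
apply: (@le_trans _ _ (act L (emx_prod n (fun i => A (k + i)%N)) (fun y => q ^+ j * w y) x)).
  apply: le_act => [|y yL].
    by have [] : localized L (emx_prod n (fun i => A (k + i)%N)) by exact: localized_prod.
  have -> : (fun i => A (k + (n + i))%N) = (fun i => A (k + n + i)%N).
    by apply/funext => i; rewrite addnA.
  exact: mP.
by rewrite actZ exprSr -mulrA ler_wpM2l ?exprn_ge0// nP.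
Qed.

(** Once [j] blocks are completed the image of [w] is below a [j]-th power times
    [w], and further factors, which do not increase [w], keep it there; an entry
    of the product is at most this image divided by [w y]. *)
Lemma lazy_cvg0 (c : R) w (A : nat -> emx R X) (d : nat -> X -> R) :
  0 <= c < 1 -> (forall x, x \in L -> 0 < w x) ->
  (forall i, localized L (A i)) -> (forall i, lazy c w (d i) (A i)) ->
  (forall x, x \in L -> (\sum_(0 <= i <oo) (1 - d i x)%:E = +oo)%E) ->
  compress_cvg0 L (fun n => emx_prod n A).
Proof.
move=> /andP[c0 c1] w0 lA zA doo x y xL yL.
have lP n : localized L (emx_prod n A) by exact: localized_prod.
have c01 : 0 <= c <= 1 by rewrite c0 ltW.
have -> : (fun n => compress L (emx_prod n A) x y) =
    (fun n => (fine (emx_prod n A x y))%:E).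
  apply/funext => n; have [P0 _ Pf] := lP n.
  by rewrite compressE// fineK// Pf.
apply: cvg_EFin; first exact: nearW.
apply/cvgrPdist_lt => e e0.
set q := c + (1 - c) / 2.
have q0 : 0 <= q by rewrite /q; lra.
have q1 : q < 1 by rewrite /q; lra.
have [j jP] : exists j, q ^+ j < e * w y / w x.
  have : q ^+ n @[n --> \oo] --> (0 : R) by apply: cvg_expr; rewrite ger0_norm.
  move=> /cvgrPdist_lt/(_ (e * w y / w x)) [|N _ /(_ N (leqnn N))].
    by rewrite divr_gt0 ?mulr_gt0 ?w0.
  by rewrite sub0r normrN ger0_norm ?exprn_ge0//; exists N.
have [n nP] := lazy_power j 0 c01 w0 lA zA doo.
exists n => // m /= nm; rewrite sub0r normrN ger0_norm; last first.
  by apply: fine_ge0; have [] := lP m.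
rewrite -(ltr_pM2r (w0 y yL)).
apply: (@le_lt_trans _ _ (act L (emx_prod m A) w x)).
  rewrite /act (big_fsetD1 y)//= lerDl big_seq; apply: sumr_ge0 => z.
  rewrite !inE => /andP[_ zL]; rewrite mulr_ge0 ?(ltW (w0 _ zL))//.
  by apply: fine_ge0; have [] := lP m.
apply: (@le_lt_trans _ _ (q ^+ j * w x)); last by rewrite -ltr_pdivlMr ?w0.
rewrite -(subnKC nm) act_prodD//; apply: le_trans (nP x xL).
apply: le_act; first by have [] := lP n.
apply: act_prod_le => // i _ z zL.
have [/andP[d0 d1] _ h] := zA (n + i)%N z zL; apply: (le_trans h).
suff : (1 - d (n + i)%N z) * (c * w z) <= (1 - d (n + i)%N z) * w z by lra.
by rewrite ler_wpM2l ?subr_ge0// (ler_piMl (ltW (w0 z zL)))// ltW.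
Qed.

End Lazy.

(** * Cleaning operators *)

Section Cleaning.
Context {R : realType} {X : countType} (L : {fset X}) (alpha : X -> X -> R)
  (alpha_ge0 : forall x y, 0 <= alpha x y).
Implicit Types (f v w : X -> R).

Local Notation alphaL := (act L (emx_of alpha)).

Lemma cleaningE f x y : (forall x, 0 <= f x) ->
  cleaning alpha f x y = ((if x == y then 1 - f x else 0) + f x * alpha x y)%:E.
Proof.
by move=> f0; rewrite /cleaning /emx_add emx_mul_diagl.
Qed.

Lemma localized_cleaning f : unit_valued f -> supp f `<=` [set` L] ->
  localized L (cleaning alpha f).
Proof.
move=> f01 fL; have f0 x : 0 <= f x by case/andP: (f01 x).
split=> [x y|x y xL yL|x y _ _]; rewrite cleaningE// ?lee_fin.
  rewrite addr_ge0 ?mulr_ge0//; case: ifP => // _.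
  by rewrite subr_ge0; case/andP: (f01 x).
have /eqP -> : f x == 0.
  by apply: contraNT xL => fx; exact: (fL x fx).
by rewrite mul0r addr0; case: eqP => // xy; rewrite xy yL in xL.
Qed.

Lemma act_cleaning f v x : unit_valued f -> x \in L ->
  act L (cleaning alpha f) v x = (1 - f x) * v x + f x * alphaL v x.
Proof.
move=> f01 xL; have f0 z : 0 <= f z by case/andP: (f01 z).
rewrite -(act_diag (L := L) (fun z => 1 - f z))// /act mulr_sumr -big_split /=.
by apply: eq_bigr => y _; rewrite cleaningE//= mulrDl -mulrA.
Qed.

Lemma act_cleaning_le f v x : unit_valued f -> x \in L ->
  alphaL v x <= v x -> act L (cleaning alpha f) v x <= v x.
Proof.
move=> f01 xL av; have /andP[f0 _] := f01 x; rewrite act_cleaning//.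
have := ler_wpM2l f0 av; lra.
Qed.

Lemma lazy_cleaning f (c : R) w : unit_valued f ->
  (forall x, x \in L -> alphaL w x <= c * w x) ->
  lazy L c w (fun x => 1 - f x) (cleaning alpha f).
Proof.
move=> f01 aw x xL; have /andP[f0 f1] := f01 x; split.
- by apply/andP; split; lra.
- rewrite cleaningE; last by move=> z; case/andP: (f01 z).
  by rewrite /= eqxx lerDl mulr_ge0.
- by rewrite act_cleaning// subKr lerD2l ler_wpM2l// aw.
Qed.

(** A strict inequality at finitely many points leaves room for a common
    factor [c < 1]. *)
Lemma spr_lt1_contraction : spr_lt1 L (emx_of alpha) ->
  exists w (c : R), [/\ 0 <= c < 1, forall x, x \in L -> 0 < w x &
    forall x, x \in L -> alphaL w x <= c * w x].
Proof.
move=> /spr_lt1_strict_supersolution[||w wP]; rewrite ?/emx_of//.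
have w0 x : x \in L -> 0 < w x by move=> /wP[].
exists w, (\big[Order.max/0]_(x : L) (alphaL w (val x) / w (val x))); split=> //.
  rewrite bigmax_ge_id /=; apply/bigmax_ltP; split=> // x _.
  by have [wx aw] := wP _ (fsvalP x); rewrite ltr_pdivrMr// mul1r.
move=> x xL; rewrite -ler_pdivrMr ?w0//.
exact: (le_bigmax _ (fun x : L => alphaL w (val x) / w (val x)) [` xL]%fset).
Qed.

End Cleaning.

(** * Clouds *)

Section CloudTilde.
Context {R : realType} {X : countType}.
Implicit Types (nu : cloud R X) (x y : X) (p s : seq X).

Lemma ancestors_rcons x p y :
  ancestors (x, rcons p y) = rcons (ancestors (x, p)) (x, rcons p y).
Proof.
have iotaSr n : iota 0 n.+1 = rcons (iota 0 n) n by rewrite -addn1 iotaD cats1.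
have -> : ancestors (x, p) = [seq (x, take j (rcons p y)) | j <- iota 0 (size p).+1].
  apply/eq_in_map => j; rewrite mem_iota /= add0n ltnS => jp.
  by rewrite -cats1 takel_cat.
rewrite -[X in rcons _ (x, X)](take_size (rcons p y)) size_rcons -map_rcons.
by rewrite -iotaSr /ancestors /level /= size_rcons.
Qed.

Lemma mem_ancestors x p s : (x, p) \in ancestors (x, p ++ s).
Proof.
apply/mapP; exists (size p); last by rewrite /= take_size_cat.
by rewrite mem_iota /= add0n /level /= size_cat ltnS leq_addr.
Qed.

Lemma ancestors_prefix x p (eta : marker X) : (x, p) \in ancestors eta ->
  exists s, eta = (x, p ++ s).
Proof.
case: eta => a q /mapP[j _ [-> ->]]; exists (drop j q).
by rewrite cat_take_drop.
Qed.

Lemma cloud_tilde_nil nu x : cloud_tilde nu (x, [::]) = nu (x, [::]).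
Proof. by rewrite /cloud_tilde /ancestors /= big_seq1. Qed.

Lemma cloud_tilde_rcons nu x p y :
  cloud_tilde nu (x, rcons p y) = cloud_tilde nu (x, p) + nu (x, rcons p y).
Proof. by rewrite /cloud_tilde ancestors_rcons big_rcons. Qed.

Lemma cloud_norm_tilde_le1 nu : cloud_ge0 nu -> (cloud_norm nu <= 1)%E ->
  forall eta, cloud_tilde nu eta <= 1.
Proof.
move=> nu0 nu1 eta; rewrite -lee_fin; apply: le_trans nu1.
apply: ereal_sup_ubound; exists eta => //; congr EFin.
by apply: eq_bigr => sigma _; rewrite ger0_norm.
Qed.

Lemma cloud_S1_tilde_le1 nu : cloud_S1 nu -> forall eta, cloud_tilde nu eta <= 1.
Proof.
move=> [_ nu1] [x p]; rewrite -lee_fin -(nu1 (x, p)).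
apply: ereal_sup_ubound; exists (x, p) => //=.
by rewrite -[in X in _ \in X](cats0 p) mem_ancestors.
Qed.

(** Beyond the last level of the cloud the sum over ancestors is constant along
    extensions, so the supremum equal to [1] is attained. *)
Lemma cloud_S1_tilde_deep nu (N : nat) : cloud_S1 nu ->
  (forall eta, (N < level eta)%N -> nu eta = 0) ->
  forall x p, (N <= size p)%N -> cloud_tilde nu (x, p) = 1.
Proof.
move=> [_ nu1] nuN x p Np; apply: EFin_inj; rewrite -(nu1 (x, p)).
have const s : cloud_tilde nu (x, p ++ s) = cloud_tilde nu (x, p).
  elim/last_ind: s => [|s y IH]; first by rewrite cats0.
  rewrite -rcons_cat cloud_tilde_rcons IH nuN ?addr0// /level /= size_rcons.
  by rewrite ltnS size_cat (leq_trans Np)// leq_addr.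
rewrite (_ : [set _ | _ in _] = [set (cloud_tilde nu (x, p))%:E]) ?ereal_sup1//.
apply/seteqP; split=> [_ [eta /ancestors_prefix[s ->] <-]|_ ->] /=.
  by rewrite const.
by exists (x, p) => //=; rewrite -[in X in _ \in X](cats0 p) mem_ancestors.
Qed.

End CloudTilde.

(** * Optional stopping along the paths inside a finite set *)

Section Words.
Context {X : choiceType} (L : {fset X}).

(** The continuations of length at most [n] of a path inside [L]. The head of a
    word is the next point visited, which makes the recursion the first-step
    decomposition of a path. *)
Fixpoint words (n : nat) : seq (seq X) :=
  if n is m.+1 then [::] :: [seq y :: s | y <- L, s <- words m] else [:: [::]].

Lemma mem_words n s : (s \in words n) = (size s <= n)%N && all (mem L) s.
Proof.
elim: n s => [|n IH] [|y s] //=.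
rewrite inE /=; apply/allpairsP/and3P => /= [[[z t] [/= zL tn [-> ->]]]|[sn yL sL]].
  by move: tn; rewrite IH ltnS => /andP[-> ->].
by exists (y, s); split=> //=; rewrite IH -ltnS sn.
Qed.

Lemma words_uniq n : uniq (words n).
Proof.
elim: n => //= n IH; apply/andP; split.
  by apply/allpairsP => -[[z t] []].
by apply: allpairs_uniq => // -[y s] [z t] _ _ /= [-> ->].
Qed.

Lemma big_words_recl (R : nmodType) n (F : seq X -> R) :
  \sum_(s <- words n.+1) F s =
  F [::] + \sum_(y <- L) \sum_(s <- words n) F (y :: s).
Proof. by rewrite big_cons big_allpairs_dep. Qed.

End Words.

Section Stopped.
Context {R : realType} {X : countType} (L : {fset X}) (alpha : X -> X -> R)
  (alpha_ge0 : forall x y, 0 <= alpha x y).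
Context (nu : cloud R X) (nu_ge0 : cloud_ge0 nu).
Implicit Types (v w : X -> R) (x y : X) (p s : seq X).

Local Notation alphaL := (act L (emx_of alpha)).

Lemma path_weight_nil x : path_weight alpha (x, [::]) = 1.
Proof. by rewrite /path_weight big_nil. Qed.

Lemma path_weight_cons x y s :
  path_weight alpha (x, y :: s) = alpha x y * path_weight alpha (y, s).
Proof. by rewrite /path_weight /= big_cons. Qed.

Lemma path_weight_ge0 x s : 0 <= path_weight alpha (x, s).
Proof.
elim: s x => [|y s IH] x; first by rewrite path_weight_nil.
by rewrite path_weight_cons mulr_ge0.
Qed.

(** Of the paths that follow the marker [(x, p)], keep those that stop after at
    most [n] further steps in [L]; this is their total weight, relative to the
    weight of [(x, p)], with [v] evaluated at the end. *)
Definition stopped (n : nat) x p v : R :=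
  \sum_(s <- words L n) nu (x, p ++ s) * path_weight alpha (last x p, s) *
                        v (last (last x p) s).

Lemma stopped0 x p v : stopped 0 x p v = nu (x, p) * v (last x p).
Proof. by rewrite /stopped /= big_seq1 cats0 path_weight_nil mulr1. Qed.

Lemma stoppedS n x p v : stopped n.+1 x p v =
  nu (x, p) * v (last x p) +
  \sum_(y <- L) alpha (last x p) y * stopped n x (rcons p y) v.
Proof.
rewrite /stopped big_words_recl cats0 path_weight_nil mulr1; congr (_ + _).
apply: eq_bigr => y _; rewrite mulr_sumr; apply: eq_bigr => s _.
rewrite path_weight_cons cat_rcons last_rcons /=; ring.
Qed.

Lemma le_stoppedS n x p v : (forall y, 0 <= v y) ->
  stopped n x p v <= stopped n.+1 x p v.
Proof.
move=> v0; elim: n p => [|n IH] p; rewrite [leRHS]stoppedS.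
  rewrite stopped0 lerDl; apply: sumr_ge0 => y _; rewrite mulr_ge0//.
  by rewrite stopped0 mulr_ge0.
by rewrite stoppedS lerD2l; apply: ler_sum => y _; rewrite ler_wpM2l.
Qed.

(** One step of optional stopping: what is not stopped at [(x, p)] moves with
    [alpha] to the next point. *)
Lemma stopped_step n x p v :
  (forall y, y \in L -> stopped n x (rcons p y) v <=
     (1 - cloud_tilde nu (x, p)) * v y) ->
  stopped n.+1 x p v <=
  nu (x, p) * v (last x p) + (1 - cloud_tilde nu (x, p)) * alphaL v (last x p).
Proof.
move=> h; rewrite stoppedS lerD2l /act mulr_sumr big_seq [leRHS]big_seq.
apply: ler_sum => y yL; rewrite /= mulrCA ler_wpM2l//; exact: h.
Qed.

(** The weight not stopped before [(x, p)] is
    [1 - cloud_tilde nu (x, p) + nu (x, p)]. Going backwards from level [N], the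
    inequality [alpha v <= v] shows that stopping later is never better than
    collecting [v] at once with all of this weight. The vector [v] may change
    sign; at level [N] only the weight left unstopped matters, and it is enough
    that it contributes a nonnegative amount: because [v] is nonnegative, or
    because no weight is left. *)
Lemma stopped_le N x v : x \in L ->
  (forall z, z \in L -> alphaL v z <= v z) ->
  (forall p, cloud_tilde nu (x, p) <= 1) ->
  (forall p, size p = N -> all (mem L) p ->
     0 <= (1 - cloud_tilde nu (x, p)) * v (last x p)) ->
  forall n p, (size p + n)%N = N -> all (mem L) p ->
  stopped n x p v <= (1 - cloud_tilde nu (x, p) + nu (x, p)) * v (last x p).
Proof.
move=> xL av nu1 leaf; elim=> [|n IH] p pN pL.
  rewrite addn0 in pN; rewrite stopped0 mulrDl lerDr; exact: leaf.
apply: (le_trans (stopped_step _)) => [y yL|].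
  have := IH (rcons p y); rewrite size_rcons addSnnS all_rcons last_rcons.
  by rewrite cloud_tilde_rcons opprD addrA subrK; apply=> //; apply/andP.
rewrite [leRHS]mulrDl [leRHS]addrC lerD2l ler_wpM2l ?subr_ge0// av//.
have : all (mem L) (x :: p) by rewrite /= xL.
by move=> /allP; apply; exact: mem_last.
Qed.

(** The same, but keeping the exact first step, where the factor gained from
    [alpha w <= c w] will be read off. *)
Lemma stopped_root_le N x v : x \in L ->
  (forall z, z \in L -> alphaL v z <= v z) ->
  (forall p, cloud_tilde nu (x, p) <= 1) ->
  (forall p, size p = N.+1 -> all (mem L) p ->
     0 <= (1 - cloud_tilde nu (x, p)) * v (last x p)) ->
  stopped N.+1 x [::] v <=
  nu (x, [::]) * v x + (1 - nu (x, [::])) * alphaL v x.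
Proof.
move=> xL av nu1 leaf; rewrite -cloud_tilde_nil.
rewrite {1}cloud_tilde_nil; apply: stopped_step => y yL.
have := stopped_le xL av nu1 leaf (n := N) (p := [:: y]).
rewrite -[[:: y]]/(rcons [::] y) cloud_tilde_rcons opprD addrA subrK; apply=> //=.
by rewrite andbT.
Qed.

(** The contribution to [T_cloud] of the markers that stay in [L] and have
    level at most [n]. *)
Definition truncation (n : nat) x y : R :=
  stopped n x [::] (fun z => (z == y)%:R).

Lemma sum_truncation n x v : x \in L ->
  \sum_(y <- L) truncation n x y * v y = stopped n x [::] v.
Proof.
move=> xL; rewrite /truncation /stopped.
under eq_bigr do rewrite mulr_suml.
rewrite exchange_big /=; apply: eq_big_seq => s; rewrite mem_words => /andP[_ sL].
have lL : last x s \in L.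
  have : all (mem L) (x :: s) by rewrite /= xL.
  by move=> /allP; apply; exact: mem_last.
rewrite (big_fsetD1 (last x s))//= eqxx mulr1 big_seq big1 ?addr0// => y.
by rewrite !inE eq_sym => /andP[/negbTE -> _]; rewrite mulr0 mul0r.
Qed.

Lemma truncation_nd x y : {homo (fun n => truncation n x y) : m n / (m <= n)%N >-> m <= n}.
Proof.
apply: homo_leq => // [|n]; first exact: le_trans.
by apply: le_stoppedS => z; case: (z == y).
Qed.

End Stopped.

(** * The matrix of a cloud *)

Section CloudMatrix.
Context {R : realType} {X : countType} (L : {fset X}) (alpha : X -> X -> R)
  (alpha_ge0 : forall x y, 0 <= alpha x y).
Context (nu : cloud R X) (nu_ge0 : cloud_ge0 nu) (nuL : carried_by L nu).
Implicit Types (v w : X -> R) (x y : X) (p s : seq X).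

Local Notation alphaL := (act L (emx_of alpha)).
Local Notation T := (T_cloud alpha nu).
Local Notation trunc := (truncation L alpha nu).
Local Notation stop := (stopped L alpha nu).

(** A marker charged by the cloud can be outside [L] only at its endpoint. *)
Lemma carried_path x s : nu (x, s) != 0 -> last x s \in L -> all (mem L) s.
Proof.
move=> nus lL; apply/allP => z zs; apply: contraNT nus => zL.
apply/eqP/nuL; exists z => //=.
have : z \in x :: s by rewrite inE zs orbT.
rewrite lastI mem_rcons inE => /orP[/eqP zl|//].
by move: zL; rewrite zl /= lL.
Qed.

Lemma T_cloud_ge0 x y : (0 <= T x y)%E.
Proof.
by apply: esum_ge0 => -[a s] _; rewrite lee_fin mulr_ge0// path_weight_ge0.
Qed.

(** For [y] in [L], every finite set of charged markers ending at [y] consists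
    of paths inside [L] of bounded length, hence is counted by some
    truncation. *)
Lemma T_cloud_sup x y : y \in L ->
  T x y = ereal_sup (range (fun n => (trunc n x y)%:E)).
Proof.
move=> yL; pose a (eta : marker X) := (nu eta * path_weight alpha eta)%:E.
have a0 eta : (0 <= a eta)%E.
  by case: eta => z s; rewrite lee_fin mulr_ge0// path_weight_ge0.
pose W n : seq (marker X) := [seq (x, s) | s <- words L n & last x s == y].
have WE n : (trunc n x y)%:E = (\sum_(eta \in [set` W n]) a eta)%E.
  rewrite -fsbig_seq; last first.
    by rewrite map_inj_uniq ?filter_uniq ?words_uniq// => s t [].
  rewrite sumEFin big_map big_filter big_mkcond; congr EFin.
  by apply: eq_bigr => s _ /=; case: ifP => _; rewrite ?mulr1 ?mulr0.
apply/eqP; rewrite eq_le; apply/andP; split; last first.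
  apply: ge_ereal_sup => _ [n _ <-]; rewrite WE; apply: esum_ge.
  exists [set` W n] => //; split; first exact: finite_seq.
  move=> eta /= /mapP[s].
  by rewrite mem_filter => /andP[/eqP lsy _] ->.
apply: ge_ereal_sup => _ [F [finF FD] <-].
(* markers of [F] outside [W n] leave [L] and have weight zero *)
pose n := (\max_(eta <- fset_set F) size eta.2)%N.
apply: (@le_trans _ _ (trunc n x y)%:E); last by apply: ereal_sup_ubound; exists n.
rewrite WE (@fsbig_widen _ _ _ _ [set` W n] (F `|` [set` W n]) a).
- apply: lee_fsum_nneg_subset => //.
    by rewrite finite_setU; split=> //; exact: finite_seq.
    by move=> eta; rewrite !inE => Fe; left.
  by move=> eta _; exact: a0.
- by move=> eta We; right.
- move=> [z s] [[Fe|//] nW]; have [/= zx lsy] := FD _ Fe; subst z.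
  rewrite /= /a; have [->|nus] := eqVneq (nu (x, s)) 0; first by rewrite mul0r.
  have sn : (size s <= n)%N.
    rewrite /n (big_rem (x, s)) /= ?leq_maxl//.
    by rewrite in_fset_set// inE.
  case: nW => /=; apply/mapP; exists s => //.
  by rewrite mem_filter lsy eqxx mem_words sn (carried_path nus) ?lsy.
Qed.

Lemma truncation_cvg x y : y \in L -> (trunc n x y)%:E @[n --> \oo] --> T x y.
Proof.
move=> yL; rewrite T_cloud_sup//; apply: ereal_nondecreasing_cvgn => m n mn.
by rewrite lee_fin truncation_nd.
Qed.

(** Starting outside [L], a cloud carried by [L] stops immediately. *)
Lemma T_cloud_outside x y : x \notin L -> y \in L -> T x y = 0%E.
Proof.
move=> xL yL; apply: esum1 => -[z s] [/= zx lsy]; subst z.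
case: s lsy => [xy|z s lsy]; first by rewrite -xy (negbTE xL) in yL.
by rewrite nuL ?mul0r//; exists x => //=; rewrite inE eqxx.
Qed.

(** A bound on the truncated sums, uniform in [n], bounds each entry because
    [w] is positive, and then passes to the limit. *)
Lemma T_cloud_fin_act_le x w (M : R) : x \in L ->
  (forall y, y \in L -> 0 < w y) ->
  (forall n, stop n.+1 x [::] w <= M) ->
  (forall y, y \in L -> T x y \is a fin_num) /\ act L T w x <= M.
Proof.
move=> xL w0 SM.
have trunc_ge0 n y : 0 <= trunc n x y.
  rewrite /truncation /stopped; apply: sumr_ge0 => s _.
  by rewrite !mulr_ge0// path_weight_ge0.
have finT y : y \in L -> T x y \is a fin_num.
  move=> yL; rewrite ge0_fin_numE ?T_cloud_ge0//.
  apply: (@le_lt_trans _ _ (M / w y)%:E); last exact: ltry.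
  apply: (cvge_to_le (truncation_cvg (x := x) yL)); exists 1%N => // -[//|n] _.
  rewrite lee_fin ler_pdivlMr ?w0//; apply: le_trans (SM n).
  rewrite -sum_truncation// (big_fsetD1 y)//= lerDl big_seq; apply: sumr_ge0 => z.
  by rewrite !inE => /andP[_ zL]; rewrite mulr_ge0 ?(ltW (w0 z zL)).
have act_cvg : stop n x [::] w @[n --> \oo] --> act L T w x.
  have -> : (fun n => stop n x [::] w) =
      (fun n => \sum_(y <- L | y \in L) trunc n x y * w y).
    by apply/funext => n; rewrite -sum_truncation// big_seq.
  rewrite /act big_seq; apply: cvg_big => [|y yL]; first exact: add_continuous.
  apply: cvgMr_tmp.
  have := truncation_cvg (x := x) yL; rewrite -{1}[T x y]fineK ?finT//.
  by move=> /fine_cvgP[].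
by split=> //; apply: (cvgr_to_le act_cvg); exists 1%N => // -[//|n] _.
Qed.

Lemma stopped_stable (N : nat) n x p v :
  (forall eta, (N < level eta)%N -> nu eta = 0) -> (N <= size p + n)%N ->
  stop n.+1 x p v = stop n x p v.
Proof.
move=> nuN; elim: n p => [|n IH] p Np.
  rewrite stoppedS !stopped0 big1 ?addr0// => y _.
  by rewrite stopped0 nuN ?mul0r ?mulr0// /level /= size_rcons ltnS -[size p]addn0.
rewrite stoppedS [RHS]stoppedS; congr (_ + _); apply: eq_bigr => y _.
by rewrite IH// size_rcons addSnnS.
Qed.

Lemma T_cloud_finite (N : nat) x y : y \in L ->
  (forall eta, (N < level eta)%N -> nu eta = 0) -> T x y = (trunc N x y)%:E.
Proof.
move=> yL nuN; apply: (cvg_unique _ (truncation_cvg (x := x) yL)) => //.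
apply: (@cvg_near_cst _ _ (trunc N x y)%:E) => //.
exists N => // n /= /subnKC <-.
elim: (n - N)%N => [|k IH]; first by rewrite addn0.
by rewrite -IH addnS /truncation (stopped_stable _ _ nuN)// add0n leq_addr.
Qed.

Lemma act_T_cloud_finite (N : nat) x v : x \in L ->
  (forall eta, (N < level eta)%N -> nu eta = 0) -> act L T v x = stop N x [::] v.
Proof.
move=> xL nuN; rewrite -sum_truncation//; apply: eq_big_seq => y yL.
by rewrite (T_cloud_finite _ yL nuN).
Qed.

Lemma localized_T_cloud_finite : finitely_many_levels nu -> localized L T.
Proof.
move=> [N nuN]; split=> [x y|x y|x y xL yL].
- exact: T_cloud_ge0.
- exact: T_cloud_outside.
- by rewrite (T_cloud_finite _ yL nuN).
Qed.

(** Optional stopping for a vector of arbitrary sign: at level [N] no weight is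
    left, so no sign of [v] is required there. *)
Lemma act_T_cloud_le v x : cloud_S1 nu -> finitely_many_levels nu ->
  (forall z, z \in L -> alphaL v z <= v z) -> x \in L -> act L T v x <= v x.
Proof.
move=> S1 [N nuN] av xL.
have t1 := cloud_S1_tilde_le1 S1.
rewrite (act_T_cloud_finite _ xL nuN).
have := stopped_le alpha_ge0 xL av (fun p => t1 (x, p)) (N := N) _ (n := N) (p := [::]).
rewrite cloud_tilde_nil subrK mul1r; apply=> // p pN _.
by rewrite (cloud_S1_tilde_deep S1 nuN) ?pN// subrr mul0r.
Qed.

Lemma stopped_root_bound (c : R) w x n : (cloud_norm nu <= 1)%E ->
  c <= 1 -> (forall z, z \in L -> 0 < w z) ->
  (forall z, z \in L -> alphaL w z <= c * w z) -> x \in L ->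
  stop n.+1 x [::] w <= nu (x, [::]) * w x + (1 - nu (x, [::])) * (c * w x).
Proof.
move=> nu1 c1 w0 aw xL; have t1 := cloud_norm_tilde_le1 nu_ge0 nu1.
apply: (@le_trans _ _ (nu (x, [::]) * w x + (1 - nu (x, [::])) * alphaL w x)).
  apply: stopped_root_le => // [z zL|p _ pL].
    by apply: (le_trans (aw z zL)); rewrite (ler_piMl (ltW (w0 z zL))).
  rewrite mulr_ge0 ?subr_ge0// ltW// w0//.
  have : all (mem L) (x :: p) by rewrite /= xL.
  by move=> /allP; apply; exact: mem_last.
by rewrite lerD2l ler_wpM2l ?aw// subr_ge0 -cloud_tilde_nil.
Qed.

Lemma localized_T_cloud (c : R) w : (cloud_norm nu <= 1)%E ->
  c <= 1 -> (forall z, z \in L -> 0 < w z) ->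
  (forall z, z \in L -> alphaL w z <= c * w z) -> localized L T.
Proof.
move=> nu1 c1 w0 aw; split=> [x y|x y|x y xL yL].
- exact: T_cloud_ge0.
- exact: T_cloud_outside.
- have [h _] := T_cloud_fin_act_le xL w0 (fun n => stopped_root_bound n nu1 c1 w0 aw xL).
  exact: h.
Qed.

Lemma lazy_T_cloud (c : R) w : (cloud_norm nu <= 1)%E ->
  c <= 1 -> (forall z, z \in L -> 0 < w z) ->
  (forall z, z \in L -> alphaL w z <= c * w z) ->
  lazy L c w (fun x => nu (x, [::])) T.
Proof.
move=> nu1 c1 w0 aw x xL; split.
- by rewrite nu_ge0 -cloud_tilde_nil cloud_norm_tilde_le1.
- have [_ _ finT] := localized_T_cloud nu1 c1 w0 aw.
  rewrite -lee_fin fineK ?finT// T_cloud_sup//.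
  apply: ereal_sup_ubound; exists 0%N => //=.
  by rewrite /truncation stopped0 /= eqxx mulr1.
- by have [_] := T_cloud_fin_act_le xL w0 (fun n => stopped_root_bound n nu1 c1 w0 aw xL).
Qed.

End CloudMatrix.

Section StepCloud.
Context {R : realType} {X : countType} (L : {fset X}).

(** The cloud of the cleaning operator of the indicator function of [L]: make
    exactly one step from a point of [L] and none from a point outside. *)
Definition step_cloud : cloud R X :=
  fun eta => ((if eta.1 \in L then 1%N else 0%N) == level eta)%:R.

Lemma step_cloud_ge0 : cloud_ge0 step_cloud.
Proof. by move=> eta; rewrite /step_cloud ler0n. Qed.

Lemma step_cloud_carried : carried_by L step_cloud.
Proof.
move=> [x [|y [|z s]]] [a] //=; rewrite /step_cloud /level /=.
  by rewrite inE => /eqP -> /negbTE ->.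
by case: ifP.
Qed.

Lemma step_cloud_levels eta : (1 < level eta)%N -> step_cloud eta = 0.
Proof.
rewrite /step_cloud => le; case: eqP => // e; move: le; rewrite -e.
by case: ifP.
Qed.

Lemma step_cloud_tilde x s :
  cloud_tilde step_cloud (x, s) = ((x \notin L) || (0 < size s)%N)%:R.
Proof.
elim/last_ind: s => [|s y IH].
  by rewrite cloud_tilde_nil /step_cloud /level /= orbF; case: ifP.
rewrite cloud_tilde_rcons IH /step_cloud /level /= size_rcons /= orbT.
by case: (x \in L); case: (size s) => [|n] /=; rewrite ?addr0 ?add0r.
Qed.

Lemma step_cloud_norm : (cloud_norm step_cloud <= 1)%E.
Proof.
apply: ge_ereal_sup => _ [[x s] _ <-].
rewrite (eq_bigr step_cloud) => [|sigma _]; last by rewrite ger0_norm// step_cloud_ge0.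
by rewrite -/(cloud_tilde _ _) step_cloud_tilde lee_fin lern1 leq_b1.
Qed.

Lemma step_cloud_S1 : cloud_S1 step_cloud.
Proof.
split=> [|[x p]]; first exact: step_cloud_ge0.
apply/eqP; rewrite eq_le; apply/andP; split.
  apply: ge_ereal_sup => _ [[z s] _ <-].
  by rewrite step_cloud_tilde lee_fin lern1 leq_b1.
apply: ereal_sup_ubound; exists (x, p ++ [:: x]); first exact: mem_ancestors.
by rewrite step_cloud_tilde size_cat addn1 orbT.
Qed.

Lemma act_step_cloud (alpha : X -> X -> R) v x : (forall x y, 0 <= alpha x y) ->
  x \in L -> act L (T_cloud alpha step_cloud) v x = act L (emx_of alpha) v x.
Proof.
move=> a0 xL; rewrite (act_T_cloud_finite a0 step_cloud_ge0 step_cloud_carried _ xL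
  step_cloud_levels).
rewrite stoppedS {1}/step_cloud /level /= xL mul0r add0r /act.
apply: eq_bigr => y _; rewrite stopped0 /step_cloud /level /= xL mul1r.
by [].
Qed.

End StepCloud.

(** * The equivalence *)

Section Equivalence.
Context {R : realType} {X : countType} (L : {fset X}) (alpha : X -> X -> R)
  (alpha_ge0 : forall x y, 0 <= alpha x y).

Local Notation alphaL := (act L (emx_of alpha)).

Lemma spr_lt1_of_inverse_positive :
  (forall v, (forall x, x \in L -> alphaL v x <= v x) ->
     forall x, x \in L -> 0 <= v x) ->
  spr_lt1 L (emx_of alpha).
Proof. by move=> M; apply/spr_lt1_inverse_positive. Qed.

Lemma spr_lt1_of_dominated A : localized L A -> spr_lt1 L A ->
  (forall v, (forall x, x \in L -> alphaL v x <= v x) ->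
     forall x, x \in L -> act L A v x <= v x) ->
  spr_lt1 L (emx_of alpha).
Proof.
move=> [A0 _ Afin] /(spr_lt1_inverse_positive A0 Afin) M dom.
by apply: spr_lt1_of_inverse_positive => v av; apply: M; exact: dom.
Qed.

(** If [alpha v <= v] then the products also satisfy [prod v <= v], while they
    send [v] to a sequence converging to zero. *)
Lemma spr_lt1_of_prod_cvg0 (A : nat -> emx R X) : (forall i, localized L (A i)) ->
  compress_cvg0 L (fun n => emx_prod n A) ->
  (forall v, (forall x, x \in L -> alphaL v x <= v x) ->
     forall i x, x \in L -> act L (A i) v x <= v x) ->
  spr_lt1 L (emx_of alpha).
Proof.
move=> lA A_cvg dom; apply: spr_lt1_of_inverse_positive => v av x xL.
have act_cvg : act L (emx_prod n A) v x @[n --> \oo] -->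
    \sum_(y <- L | y \in L) 0 * v y.
  have -> : (fun n => act L (emx_prod n A) v x) =
      (fun n => \sum_(y <- L | y \in L) fine (compress L (emx_prod n A) x y) * v y).
    apply/funext => n; rewrite /act big_seq; apply: eq_bigr => y yL.
    by rewrite compressE//; have [] : localized L (emx_prod n A) by exact: localized_prod.
  apply: cvg_big => [|y yL]; first exact: add_continuous.
  by apply: cvgMr_tmp; have /fine_cvgP[] := A_cvg x y xL yL.
rewrite big1 in act_cvg => [|y _]; last by rewrite mul0r.
apply: (cvgr_to_le act_cvg); apply: nearW => n.
by apply: act_prod_le => // i _; exact: dom.
Qed.

Lemma prod_lt1 (m : nat) (d : nat -> R) (k : nat) :
  (forall i, (i < m)%N -> 0 <= d i <= 1) -> (k < m)%N -> d k < 1 ->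
  \prod_(i < m) d i < 1.
Proof.
move=> d01 km dk; rewrite (bigD1 (Ordinal km))//=.
apply: le_lt_trans dk; rewrite ler_piMr//; first by case/andP: (d01 k km).
by apply: prodr_ile1 => i _; exact: d01.
Qed.

Lemma prod_cleaning_spr_lt1 (m : nat) (f : nat -> X -> R) :
  spr_lt1 L (emx_of alpha) -> (forall i, (i < m)%N -> unit_valued (f i)) ->
  supp (fun x => \sum_(i < m) f i x) = [set` L] ->
  spr_lt1 L (emx_prod m (fun i => cleaning alpha (f i))).
Proof.
move=> /(spr_lt1_contraction alpha_ge0)[w [c [/andP[c0 c1] w0 aw]]] f01 fL.
have f0 i x : (i < m)%N -> 0 <= f i x by move=> im; case/andP: (f01 i im x).
have fsupp i : (i < m)%N -> supp (f i) `<=` [set` L].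
  rewrite -fL => im x; rewrite /supp /= => fx; rewrite gt_eqF//.
  rewrite (bigD1 (Ordinal im))//= ltr_wpDr ?lt0r ?fx ?f0//.
  by apply: sumr_ge0 => j _; exact: f0.
have lA i : (i < m)%N -> localized L (cleaning alpha (f i)).
  by move=> im; apply: localized_cleaning => //; [exact: f01|exact: fsupp].
have [P0 _ Pfin] := localized_prod lA.
apply/spr_lt1_strict_supersolution => //; exists w => x xL; split; first exact: w0.
apply: (@le_lt_trans _ _ ((c + (1 - c) * \prod_(i < m) (1 - f i x)) * w x)).
  apply: (@lazy_prod _ _ _ c w m _ (fun i x => 1 - f i x)) => //.
    by rewrite c0 ltW.
  by move=> i im; apply: lazy_cleaning => //; exact: f01.
rewrite -[ltRHS]mul1r ltr_pM2r ?w0//.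
have [k km fk] : exists2 k, (k < m)%N & 0 < f k x.
  apply: contrapT => /forall2NP h.
  have : supp (fun x => \sum_(i < m) f i x) x by rewrite fL.
  rewrite /supp /= big1 ?eqxx// => i _; apply/eqP; rewrite eq_le f0// andbT.
  by case: (h i) => [|/negP]; [case|rewrite -leNgt].
have : \prod_(i < m) (1 - f i x) < 1.
  apply: (@prod_lt1 m (fun i => 1 - f i x) k) => //; last by lra.
  by move=> i im; have /andP[g0 g1] := f01 i im x; apply/andP; split; lra.
move=> P1; rewrite -ltrBrDl -[ltRHS]mulr1 ltr_pM2l//; lra.
Qed.

Lemma cleaning_spr_lt1 (h : X -> R) :
  spr_lt1 L (emx_of alpha) -> unit_valued h -> supp h = [set` L] ->
  spr_lt1 L (cleaning alpha h).
Proof.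
move=> /(spr_lt1_contraction alpha_ge0)[w [c [/andP[c0 c1] w0 aw]]] h01 hL.
have [C0 _ Cfin] : localized L (cleaning alpha h).
  by apply: localized_cleaning => //; rewrite hL.
apply/spr_lt1_strict_supersolution => //; exists w => x xL; split; first exact: w0.
have [_ _ /le_lt_trans] := lazy_cleaning alpha_ge0 h01 aw xL; apply.
have hx : 0 < h x.
  rewrite lt0r; have /andP[-> _] := h01 x; rewrite andbT.
  by have : supp h x by rewrite hL.
have : (1 - c) * (h x * w x) > 0 by rewrite !mulr_gt0 ?w0// subr_gt0.
lra.
Qed.

Lemma T_cloud_spr_lt1 (nu : cloud R X) : spr_lt1 L (emx_of alpha) ->
  cloud_ge0 nu -> carried_by L nu -> (cloud_norm nu <= 1)%E ->
  (forall x, x \in L -> nu (x, [::]) < 1) -> spr_lt1 L (T_cloud alpha nu).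
Proof.
move=> /(spr_lt1_contraction alpha_ge0)[w [c [/andP[c0 c1] w0 aw]]].
move=> nu0 nuL nu1 nux.
have [T0 _ Tfin] := localized_T_cloud alpha_ge0 nu0 nuL nu1 (ltW c1) w0 aw.
apply/spr_lt1_strict_supersolution => //; exists w => x xL; split; first exact: w0.
have [_ _ /le_lt_trans] := lazy_T_cloud alpha_ge0 nu0 nuL nu1 (ltW c1) w0 aw xL; apply.
have : (1 - c) * ((1 - nu (x, [::])) * w x) > 0.
  by rewrite !mulr_gt0 ?w0// subr_gt0// nux.
lra.
Qed.

End Equivalence.

Theorem corollary6p2 (R : realType) (X : countType) (hX : inhabited X)
    (L : {fset X}) (alpha : X -> X -> R) (alpha_ge0 : forall x y, 0 <= alpha x y) :
  [<->
    (* (a) *)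
    spr_lt1 L (emx_of alpha);
    (* (b) *)
    forall h : X -> R, unit_valued h -> supp h = [set` L] ->
      spr_lt1 L (cleaning alpha h);
    (* (b') *)
    exists h : X -> R, [/\ unit_valued h, supp h `<=` [set` L] &
      spr_lt1 L (cleaning alpha h)];
    (* (c) *)
    forall (m : nat) (f : nat -> X -> R),
      (forall i, (i < m)%N -> unit_valued (f i)) ->
      supp (fun x => \sum_(i < m) f i x) = [set` L] ->
      spr_lt1 L (emx_prod m (fun i => cleaning alpha (f i)));
    (* (c') *)
    exists (m : nat) (f : nat -> X -> R),
      [/\ forall i, (i < m)%N -> unit_valued (f i),
          forall i, (i < m)%N -> supp (f i) `<=` [set` L] &
          spr_lt1 L (emx_prod m (fun i => cleaning alpha (f i)))];
    (* (d) *)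
    forall nu : cloud R X, cloud_ge0 nu -> carried_by L nu ->
      (cloud_norm nu <= 1)%E -> (forall x, x \in L -> nu (x, [::]) < 1) ->
      spr_lt1 L (T_cloud alpha nu);
    (* (d') *)
    exists nu : cloud R X,
      [/\ cloud_S1 nu, carried_by L nu, finitely_many_levels nu &
          spr_lt1 L (T_cloud alpha nu)];
    (* (e) *)
    forall f : nat -> X -> R,
      (forall i, unit_valued (f i)) ->
      (forall i, supp (f i) `<=` [set` L]) ->
      (forall x, x \in L -> (\sum_(0 <= i <oo) (f i x)%:E = +oo)%E) ->
      compress_cvg0 L (fun n => emx_prod n (fun i => cleaning alpha (f i)));
    (* (f) *)
    forall nu : nat -> cloud R X,
      (forall i, cloud_ge0 (nu i)) ->
      (forall i, carried_by L (nu i)) ->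
      (forall i, (cloud_norm (nu i) <= 1)%E) ->
      (forall x, x \in L ->
        (\sum_(0 <= i <oo) (1 - nu i (x, [::]))%:E = +oo)%E) ->
      compress_cvg0 L (fun n => emx_prod n (fun i => T_cloud alpha (nu i)))
  ].
Proof.
pose chi x : R := if x \in L then 1 else 0.
have chi01 : unit_valued chi.
  by move=> x; rewrite /chi; case: ifP => _; rewrite ?lexx ?ler01.
have chiL : supp chi = [set` L].
  apply/seteqP; split=> x; rewrite /supp /chi /=; case: ifP => //.
  by rewrite eqxx.
(* the divergence condition for the indicator function of [L] *)
have sum1 : (\sum_(0 <= i <oo) (1 : R)%:E = +oo)%E.
  apply/eqyP => M M0; have [n Mn] : exists n : nat, M <= n%:R.
    by exists (Num.bound M); rewrite ltW// archi_boundP// ltW.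
  apply: (@le_trans _ _ (\sum_(0 <= i < n) (1 : R)%:E)%E); last first.
    by apply: nneseries_lim_ge => i _ _; rewrite lee_fin ler01.
  by rewrite sumEFin lee_fin big_mkord sumr_const card_ord.
tfae.
- by move=> sa h; exact: cleaning_spr_lt1.
- by move=> sb; exists chi; split=> //; [rewrite chiL|exact: sb].
- move=> [h [h01 hL sh]].
  have sa : spr_lt1 L (emx_of alpha).
    apply: (spr_lt1_of_dominated alpha_ge0 _ sh); first exact: localized_cleaning.
    by move=> v av x xL; apply: act_cleaning_le => //; exact: av.
  by move=> m f f01 fL; exact: (prod_cleaning_spr_lt1 alpha_ge0 sa f01 fL).
- move=> sc; exists 1%N, (fun=> chi); split=> // [i _|]; first by rewrite chiL.
  apply: sc => //; rewrite -chiL; congr supp.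
  by apply/funext => x; rewrite big_ord1.
- move=> [m [f [f01 fL sf]]].
  have lA i : (i < m)%N -> localized L (cleaning alpha (f i)).
    by move=> im; apply: localized_cleaning => //; [exact: f01|exact: fL].
  have sa : spr_lt1 L (emx_of alpha).
    apply: (spr_lt1_of_dominated alpha_ge0 _ sf); first exact: localized_prod.
    move=> v av; apply: act_prod_le => // i im x xL.
    by apply: act_cleaning_le => //; [exact: f01|exact: av].
  by move=> nu nu0 nuL nu1 nux; exact: (T_cloud_spr_lt1 alpha_ge0 sa nu0 nuL nu1 nux).
- move=> sd; exists (step_cloud L); split.
  + exact: step_cloud_S1.
  + exact: step_cloud_carried.
  + by exists 1%N; exact: step_cloud_levels.
  + apply: sd; [exact: step_cloud_ge0|exact: step_cloud_carried|exact: step_cloud_norm|].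
    by move=> x xL; rewrite /step_cloud /level /= xL ltr01.
- move=> [nu [nuS nuL nuN sn]] f f01 fL foo.
  have nu0 : cloud_ge0 nu by case: nuS.
  have sa : spr_lt1 L (emx_of alpha).
    apply: (spr_lt1_of_dominated alpha_ge0 _ sn).
      exact: localized_T_cloud_finite.
    by move=> v av x xL; exact: act_T_cloud_le.
  have [w [c [/andP[c0 c1] w0 aw]]] := spr_lt1_contraction alpha_ge0 sa.
  apply: (@lazy_cvg0 _ _ L c w _ (fun i x => 1 - f i x)) => //.
  + by rewrite c0.
  + by move=> i; exact: localized_cleaning.
  + by move=> i; exact: lazy_cleaning.
  + move=> x xL; rewrite -(foo x xL); apply: eq_eseriesr => i _.
    by rewrite subKr.
- move=> se nu nu0 nuL nu1 nuoo.
  have sa : spr_lt1 L (emx_of alpha).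
    apply: (@spr_lt1_of_prod_cvg0 _ _ _ _ alpha_ge0 (fun=> cleaning alpha chi)).
    + by move=> _; apply: localized_cleaning => //; rewrite chiL.
    + apply: se => // [i|x xL]; first by rewrite chiL.
      by rewrite /chi xL.
    + by move=> v av i x xL; apply: act_cleaning_le => //; exact: av.
  have [w [c [/andP[c0 c1] w0 aw]]] := spr_lt1_contraction alpha_ge0 sa.
  apply: (@lazy_cvg0 _ _ L c w _ (fun i x => nu i (x, [::]))) => //.
  + by rewrite c0.
  + by move=> i; apply: (localized_T_cloud _ _ _ _ (ltW c1) w0 aw).
  + by move=> i; apply: (lazy_T_cloud _ _ _ _ (ltW c1) w0 aw).
- move=> sf.
  apply: (@spr_lt1_of_prod_cvg0 _ _ _ _ alpha_ge0 (fun=> T_cloud alpha (step_cloud L))).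
  + move=> _; apply: (localized_T_cloud_finite alpha_ge0 _ _ _).
    * exact: step_cloud_ge0.
    * exact: step_cloud_carried.
    * by exists 1%N; exact: step_cloud_levels.
  + apply: sf => [_|_|_|x xL].
    * exact: step_cloud_ge0.
    * exact: step_cloud_carried.
    * exact: step_cloud_norm.
    * by rewrite /step_cloud /level /= xL subr0.
  + by move=> v av i x xL; rewrite act_step_cloud// av.
Qed.
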